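(* Let $G$ be a $3$-connected planar graph. Then, up to equivalence, $G$ has a unique polyhedral embedding. That is, $G$ has a polyhedral embedding in some orientable surface (of any genus), and any two polyhedral embeddings of $G$ in orientable surfaces (of any, possibly different, genera) are either identical or mirror images of each other.
   Context: Graphs are finite, simple and undirected. A graph is $3$-connected if it has at least $4$ vertices and remains connected after deleting any set of at most $2$ vertices. Embeddings in orientable surfaces are described combinatorially. Each undirected edge $\{u,v\}$ is interpreted as two directed edges $e=(u,v)$ and $e^{-1}=(v,u)$. An embedding of a graph (with fixed vertex set and edge set) is a choice, for every vertex $u$, of a cyclic order of all directed edges $(u,\cdot)$ starting at $u$ (interpreted as clockwise order). For a directed edge $e$, $\mathrm{nx}(e)$ denotes the next edge after $e$ in the cyclic order around the starting vertex of $e$. The mirror image (inverse) of an embedding is the embedding obtained by reversing all the cyclic orders. Two embeddings of the same graph are equivalent if they are equal or one is the mirror image of the other. A face of an embedding is a directed cyclic walk $e_0,\dots,e_{n-1}$ with $\mathrm{nx}(e_i^{-1})=e_{(i+1) \bmod n}$ for all $0\le i<n$; i.e. the faces are the orbits of the permutation $e\mapsto \mathrm{nx}(e^{-1})$ on directed edges. The genus of an embedding of a connected graph with $v$ vertices, $e$ undirected edges and $f$ faces is $\gamma=\frac{2-(v-e+f)}{2}$. A graph is planar if it has an embedding of genus $0$. A polyhedral embedding of a graph in an orientable surface is an embedding such that each facial walk is a simple cycle and the intersection of any two distinct faces (as subgraphs, i.e. their common vertices and edges) is either empty, a single vertex, or a single edge (with its two endpoints). *)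

(* Defs.v *)
From mathcomp Require Import all_boot all_order all_fingroup all_algebra.

Set Implicit Arguments.
Unset Strict Implicit.
Unset Printing Implicit Defensive.

Import GRing.Theory.

Record sgraph := SGraph {
  svertex :> finType;
  sedge : rel svertex;
  sedge_sym : symmetric sedge;
  sedge_irrefl : irreflexive sedge }.

Section Graph.
Variable G : sgraph.

Definition edges : {set {set G}} :=
  [set [set p.1; p.2] | p : G * G & sedge p.1 p.2].

Definition connected_without (S : {set G}) : Prop :=
  forall x y, x \notin S -> y \notin S ->
    connect [rel u v | [&& u \notin S, v \notin S & sedge u v]] x y.

Definition three_connected : Prop :=
  (4 <= #|G|)%N /\ forall S : {set G}, (#|S| <= 2)%N -> connected_without S.

Definition dart : finType := {p : G * G | sedge p.1 p.2}.

Definition source (d : dart) : G := (val d).1.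
Definition target (d : dart) : G := (val d).2.

Lemma drev_subproof (d : dart) : sedge (target d, source d).1 (target d, source d).2.
Proof. by rewrite /= sedge_sym; exact: (valP d). Qed.

Definition drev (d : dart) : dart := exist _ (target d, source d) (drev_subproof d).

Lemma drevK : involutive drev.
Proof. by move=> d; apply: val_inj; case: d => -[]. Qed.

Definition drev_perm : {perm dart} := perm (inv_inj drevK).

(* A cyclic order on each set of darts with a common source is encoded by its
   successor permutation nx, which acts on each such set as a single cycle. *)
Record embedding := Embedding {
  nx : {perm dart};
  nx_rotation :
    [forall d : dart, forall d' : dart,
       (d' \in porbit nx d) == (source d' == source d)] }.

Lemma mirror_subproof (E : embedding) :
  [forall d : dart, forall d' : dart,
     (d' \in porbit (nx E)^-1%g d) == (source d' == source d)].
Proof.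
have/forallP H := nx_rotation E.
by apply/forallP => d; apply/forallP => d'; rewrite porbitV; move/forallP: (H d).
Qed.

Definition mirror (E : embedding) : embedding := Embedding (mirror_subproof E).

Definition equivalent (E1 E2 : embedding) : Prop := E1 = E2 \/ E1 = mirror E2.

(* Products of permutations are read left to right: this is d |-> nx (drev d). *)
Definition face_perm (E : embedding) : {perm dart} := (drev_perm * nx E)%g.

(* A face is identified with its set of darts, an orbit of face_perm. *)
Definition faces (E : embedding) : {set {set dart}} := porbits (face_perm E).

Definition genus (E : embedding) : rat :=
  ((2 - (#|G|%:R - #|edges|%:R + #|faces E|%:R)) / 2)%R.

(* The genus formula is the surface genus only for connected graphs. *)
Definition planar : Prop := exists E : embedding, genus E = 0%R.

Definition face_vertices (F : {set dart}) : {set G} := [set source d | d in F].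

Definition face_edges (F : {set dart}) : {set {set G}} :=
  [set [set source d; target d] | d in F].

Definition simple_cycle (F : {set dart}) : Prop :=
  (3 <= #|F|)%N /\ {in F &, injective source}.

Definition proper_intersection (F1 F2 : {set dart}) : Prop :=
  let VI := face_vertices F1 :&: face_vertices F2 in
  let EI := face_edges F1 :&: face_edges F2 in
  [\/ VI = set0 /\ EI = set0,
      exists v, VI = [set v] /\ EI = set0
    | exists u v, [/\ sedge u v, VI = [set u; v] & EI = [set [set u; v]]]].

Definition polyhedral (E : embedding) : Prop :=
  (forall F, F \in faces E -> simple_cycle F) /\
  (forall F1 F2, F1 \in faces E -> F2 \in faces E -> F1 != F2 ->
     proper_intersection F1 F2).

End Graph.

(* Main.v *)
Require Import Defs.
From HB Require Import structures.
From mathcomp Require Import all_boot all_fingroup all_algebra zify.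

(* Counting dimensions over F_2, Euler's formula makes the sequence
   vertex functions -> edge functions -> face functions of a genus 0 embedding exact
   in the middle; exchanging vertices and faces, every mod 2 cycle is a sum of faces.
   - A curve through at most two vertices of a genus 0 embedding crosses the edges of a
     cocycle, which is then a cut; 3-connectivity makes the cut trivial. Hence faces are
     simple cycles and two faces meet properly, so a genus 0 embedding is polyhedral.
   - In a polyhedral embedding of any genus, a face F is an induced cycle, and the faces
     around F link all edges leaving F, so F does not separate the graph. In a genus 0
     embedding F is a sum of faces; since G - F is connected, all of G - F lies on one
     side, and a face on the other side uses only edges of F, hence is F or its reverse.
   - So at every corner the two rotations agree or are opposite, and which of the two
     happens is constant around vertices, around faces, hence everywhere. *)

Set Implicit Arguments.
Unset Strict Implicit.
Unset Printing Implicit Defensive.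

Import GRing.Theory Num.Theory.
Local Open Scope ring_scope.

(** * Exactness over F_2 *)

Lemma sum_indicator (T : finType) (P : pred T) x :
  \sum_(y | P y) (y == x) = P x :> bool.
Proof.
rewrite big_mkcond /= (bigD1 x) //= eqxx big1 ?addr0 => [|y /negPf ->]; by case: (P _).
Qed.

Section EulerExact.
(** The setting is abstract because it is instantiated twice: [D] is the set of darts, [e] reverses
    them, and [a], [b] are source vertex and face in one order, then in the other. *)
Variables (D VT ET FT : finType) (e : D -> D).
Variables (a : D -> VT) (h : D -> ET) (b : D -> FT).
Hypothesis h_e : forall d d', (h d == h d') = (d' == d) || (d' == e d).
Hypothesis h_surj : forall x, exists d, h d == x.
Hypothesis e_neq : forall d, e d != d.
Hypothesis a_conn : forall p : pred VT,
  (forall d, p (a d) = p (a (e d))) -> forall x y, p x = p y.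
Hypothesis b_conn : forall p : pred FT,
  (forall d, p (b d) = p (b (e d))) -> forall x y, p x = p y.
Hypothesis euler : (#|ET| + 2 <= #|VT| + #|FT|)%N.
(** This makes [face_sum] after [coboundary] zero, so that the two maps form a complex. *)
Hypothesis balance : forall (p : pred VT) t,
  \sum_(d | b d == t) p (a (e d)) = \sum_(d | b d == t) p (a d) :> bool.

Let CV := {ffun VT -> bool^o}.
Let CE := {ffun ET -> bool^o}.
Let CF := {ffun FT -> bool^o}.

Let e_inv d : e (e d) = d.
Proof.
have: h (e d) == h d by rewrite eq_sym h_e eqxx orbT.
by rewrite h_e => /orP[/eqP E|/eqP]; [have := e_neq d; rewrite -E eqxx|].
Qed.

Let rep (x : ET) : D := xchoose (h_surj x).
Let repP x : h (rep x) = x.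
Proof. by apply/eqP; exact: xchooseP (h_surj x). Qed.

(** The orientation [rep x] chosen for an edge does not matter in characteristic 2. *)
Definition coboundary (p : CV) : CE := [ffun x => p (a (rep x)) + p (a (e (rep x)))].
Definition face_sum (c : CE) : CF := [ffun t => \sum_(d | b d == t) c (h d)].

Lemma coboundary_linear : linear coboundary.
Proof.
move=> k p q; apply/ffunP=> x; rewrite !ffunE /= scalerDr; exact: addrACA.
Qed.
Lemma face_sum_linear : linear face_sum.
Proof.
move=> k c c'; apply/ffunP=> t; rewrite !ffunE /= scaler_sumr -big_split.
by apply: eq_bigr => d _; rewrite !ffunE.
Qed.
HB.instance Definition _ := GRing.isLinear.Build _ _ _ _ _ coboundary_linear.
HB.instance Definition _ := GRing.isLinear.Build _ _ _ _ _ face_sum_linear.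

Let d0 := linfun coboundary.
Let d1 := linfun face_sum.

Lemma coboundaryE p d : coboundary p (h d) = p (a d) (+) p (a (e d)).
Proof.
rewrite ffunE; have /eqP : h d == h (rep (h d)) by rewrite repP.
by move/eqP; rewrite h_e => /orP[]/eqP -> //; rewrite e_inv; exact: addrC.
Qed.

Lemma face_sum_coboundary p : face_sum (coboundary p) = 0.
Proof.
apply/ffunP=> t; rewrite !ffunE.
rewrite (eq_bigr (fun d => (p (a d) : bool) + p (a (e d)))); last first.
  by move=> d _; rewrite coboundaryE.
by rewrite big_split /= (balance p); exact: addbb.
Qed.

(** By [a_conn], a function with zero coboundary is constant. *)
Lemma dim_lker_coboundary : (\dim (lker d0) <= 1)%N.
Proof.
suff: (lker d0 <= <[ [ffun=> true] : CV ]>)%VS.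
  by move/dimvS => /leq_trans; apply; rewrite dim_vline; case: eqP.
apply/subvP=> p; rewrite memv_ker lfunE /= => /eqP p0.
have cst x y : p x = p y.
  apply: a_conn => d; have := congr1 (fun c : CE => c (h d)) p0.
  by rewrite /= coboundaryE ffunE; case: (p (a d)); case: (p _).
case: (pickP [pred x | p x]) => [x /= px|p0'].
  have ->: p = [ffun=> true] by apply/ffunP=> y; rewrite ffunE (cst y x).
  exact: memv_line.
have ->: p = 0 by apply/ffunP=> y; rewrite ffunE; exact: p0'.
exact: mem0v.
Qed.

Let dirac (t : FT) : CF := [ffun t' => t' == t].

(** This is the image of the indicator of the edge of [d]. *)
Lemma dirac_face_sum d : dirac (b d) + dirac (b (e d)) \in limg d1.
Proof.
apply/memv_imgP; exists [ffun x => x == h d]; first exact: memvf.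
apply/ffunP=> t; rewrite lfunE /= !ffunE.
rewrite (eq_bigr (fun d' : D => ((d' == d) + (d' == e d) : bool))); last first.
  move=> d' _; rewrite ffunE eq_sym h_e.
  by case: eqP => [->|] //; rewrite eq_sym (negPf (e_neq d)).
by rewrite big_split /= !sum_indicator eq_sym (eq_sym t).
Qed.

(** Modulo the image, Dirac functions of adjacent faces coincide, hence by [b_conn] all do; the
    image and a single Dirac function span everything. *)
Lemma dim_limg_face_sum : (#|FT| <= \dim (limg d1) + 1)%N.
Proof.
case: (pickP (@predT FT)) => [t0 _|/eq_card0 ->] //.
have conn t : dirac t0 + dirac t \in limg d1.
  have ->: (dirac t0 + dirac t \in limg d1) = (dirac t0 + dirac t0 \in limg d1).
    apply: (b_conn (p := fun t => dirac t0 + dirac t \in limg d1)) => d.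
    rewrite -[RHS](rpredDr _ (dirac_face_sum d)).
    suff -> : dirac t0 + dirac (b d) = dirac t0 +
      dirac (b (e d)) + (dirac (b d) + dirac (b (e d))) by [].
    apply/ffunP=> x; rewrite !ffunE.
    by case: (x == t0); case: (x == b d); case: (x == b (e d)).
  have ->: dirac t0 + dirac t0 = 0 by apply/ffunP=> x; rewrite !ffunE; exact: addbb.
  exact: mem0v.
have full : (fullv <= limg d1 + <[dirac t0]>)%VS.
  apply/subvP=> c _.
  have ->: c = \sum_t c t *: dirac t.
    apply/ffunP=> t; rewrite sum_ffunE (bigD1 t) //= big1 => [|i it].
      by rewrite !ffunE eqxx addr0 /GRing.scale /= mulr1.
    by rewrite !ffunE eq_sym (negPf it) /GRing.scale /= mulr0.
  apply: memv_suml => t _; apply: memvZ.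
  have ->: dirac t = (dirac t0 + dirac t) + dirac t0.
    apply/ffunP=> x; rewrite !ffunE.
    by case: (x == t0); case: (x == t).
  by apply: memv_add; [exact: conn|exact: memv_line].
have /dimvS := full; rewrite dimvf [dim _]muln1 => /leq_trans; apply.
apply: leq_trans (dimv_add_leqif _ _) _.
by rewrite leq_add2l dim_vline; case: eqP.
Qed.

(** One inclusion holds in any complex. For the other, the image has dimension at least [#|VT| - 1]
    and the kernel at most [#|ET| - #|FT| + 1], so [euler] leaves no room between them. *)
Lemma limg_coboundary : limg d0 = lker d1.
Proof.
apply/eqP; rewrite eqEdim; apply/andP; split.
  apply/subvP=> c /memv_imgP[p _ ->].
  by rewrite memv_ker !lfunE /= face_sum_coboundary.
have := limg_ker_dim d0 fullv; have := limg_ker_dim d1 fullv.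
rewrite !capfv !dimvf [dim CE]muln1 [dim CV]muln1.
have := dim_lker_coboundary; have := dim_limg_face_sum; have := euler.
by lia.
Qed.

Theorem euler_exact (c : D -> bool) :
  (forall d, c (e d) = c d) -> (forall t, \sum_(d | b d == t) c d = 0 :> bool) ->
  exists p : VT -> bool, forall d, c d = p (a d) (+) p (a (e d)).
Proof.
move=> ce c0; pose C : CE := [ffun x => c (rep x)].
have CE' d : C (h d) = c d.
  rewrite ffunE; have : h d == h (rep (h d)) by rewrite repP.
  by rewrite h_e => /orP[]/eqP ->.
have: C \in limg d0.
  rewrite limg_coboundary memv_ker lfunE; apply/eqP/ffunP=> t; rewrite !ffunE -[RHS](c0 t).
  by apply: eq_bigr => d _; rewrite CE'.
case/memv_imgP=> p _ Cp; exists p => d.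
by rewrite -CE' Cp lfunE coboundaryE.
Qed.

End EulerExact.

(** * Permutations and orbits *)

Lemma porbit_ind (T : finType) (s : {perm T}) (P : T -> Prop) x :
  P x -> (forall y, y \in porbit s x -> P y -> P (s y)) ->
  forall y, y \in porbit s x -> P y.
Proof.
move=> Px Ps y /porbitP[i ->]; elim: i => [|i IH]; first by rewrite expg0 perm1.
by rewrite expgSr permM; apply: Ps => //; exact: mem_porbit.
Qed.

Lemma porbit_invariant (T : finType) (A : Type) (s : {perm T}) (r : T -> A) x y :
  (forall z, r (s z) = r z) -> y \in porbit s x -> r y = r x.
Proof. by move=> rs; apply: (porbit_ind (P := fun y => r y = r x)) => // z _ <-. Qed.

Lemma mem_porbitS (T : finType) (s : {perm T}) x y : (s y \in porbit s x) = (y \in porbit s x).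
Proof.
by rewrite porbit_sym -{1}[s y]/((s ^+ 1)%g y) porbit_perm porbit_sym.
Qed.

(* [k] is, mod 2, the arc from [x] to [y] in the cyclic order [s]. *)
Lemma porbit_arc (T : finType) (s : {perm T}) x y : y \in porbit s x ->
  exists k : T -> bool, (forall z, k z -> z \in porbit s x) /\
    forall z, k (s z) (+) k z = (s z == x) (+) (s z == y).
Proof.
case/porbitP=> n ->; exists (fun z => \sum_(i < n) (z == (s ^+ i)%g x)); split=> [z|z].
  case: (boolP (z \in _)) => // zx; rewrite big1 => [|i _]; first exact.
  by apply/negbTE; apply: contra zx => /eqP ->; exact: mem_porbit.
elim: n => [|n IH]; first by rewrite !big_ord0 expg0 perm1; case: eqP.
rewrite !big_ord_recr /= -[_ == (s ^+ n.+1)%g x]/(s z == _) expgSr permM (inj_eq perm_inj).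
move: IH; rewrite /GRing.add /=; do 2![case: (\sum_(i < n) _)]; case: (s z == x);
 case: (s z == _); case: (z == _) => //.
Qed.

(** * Darts, rotations and faces *)

Section Graph.
Variable G : sgraph.
Implicit Types d : dart G.

Lemma source_drev d : source (drev d) = target d. Proof. by []. Qed.
Lemma target_drev d : target (drev d) = source d. Proof. by []. Qed.

Lemma source_neq_target d : source d != target d.
Proof. by apply/eqP => E; have := valP d; rewrite -/(source d) E sedge_irrefl. Qed.

Lemma dart_eq d d' : source d = source d' -> target d = target d' -> d = d'.
Proof.
move=> E1 E2; apply: val_inj; rewrite [LHS]surjective_pairing [RHS]surjective_pairing.
by congr (_, _).
Qed.

Lemma drev_neq d : drev d != d.
Proof.
by apply/eqP=> E; have := source_neq_target d; rewrite -{1}E source_drev eqxx.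
Qed.

Lemma dart_of u v : sedge u v -> exists d : dart G, source d = u /\ target d = v.
Proof. by move=> uv; exists (exist _ (u, v) uv). Qed.

Lemma eq_dart_edge d d' :
  ([set source d; target d] == [set source d'; target d']) = (d' == d) || (d' == drev d).
Proof.
apply/eqP/orP => [E|[/eqP->|/eqP->]] //; last by rewrite source_drev target_drev setUC.
have: source d' \in [set source d; target d] by rewrite E set21.
have: target d' \in [set source d; target d] by rewrite E set22.
have := source_neq_target d'.
rewrite !inE => N /orP[]/eqP T /orP[]/eqP S; move: N; rewrite S T ?eqxx // => _.
- by right; apply/eqP; exact: dart_eq.
- by left; apply/eqP; exact: dart_eq.
Qed.

(** The form in which connectivity is used throughout: locally constant functions are constant. *)
Lemma connected_without_const (S : {set G}) (p : G -> bool) :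
  connected_without S ->
  (forall d, source d \notin S -> target d \notin S -> p (source d) = p (target d)) ->
  forall x y, x \notin S -> y \notin S -> p x = p y.
Proof.
move=> C pd x y xS yS; have /connectP[w] := C x y xS yS.
elim: w x {xS} => [|z w IH] x /= => [_ ->//|/andP[/and3P[xS zS xz]]] pw yl.
rewrite -(IH z) //; have [d [dx dz]] := dart_of xz.
by have := pd d; rewrite dx dz => ->.
Qed.

Section Rotation.
Variable E : embedding G.
Local Notation f := (face_perm E).
Local Notation face d := (porbit (face_perm E) d).

Lemma mem_porbit_nx d d' : (d' \in porbit (nx E) d) = (source d' == source d).
Proof. by have /forallP/(_ d)/forallP/(_ d')/eqP := nx_rotation E. Qed.

Lemma face_permE d : f d = nx E (drev d).
Proof. by rewrite permM permE. Qed.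

Lemma face_perm_drev d : f (drev d) = nx E d.
Proof. by rewrite face_permE drevK. Qed.

Lemma source_nx d : source (nx E d) = source d.
Proof. by apply/eqP; rewrite -mem_porbit_nx -{1}[nx E]expg1 mem_porbit. Qed.

Lemma source_face d : source (f d) = target d.
Proof. by rewrite face_permE source_nx source_drev. Qed.

Lemma nx_invariant (A : Type) (r : dart G -> A) : (forall d, r (nx E d) = r d) ->
  forall d d', source d = source d' -> r d = r d'.
Proof. by move=> rn d d' S; apply: (porbit_invariant rn); rewrite mem_porbit_nx S. Qed.

Lemma mem_faces F : F \in faces E -> exists d, F = face d.
Proof. by case/imsetP=> d _ ->; exists d. Qed.

Lemma face_in_faces d : face d \in faces E.
Proof. exact: imset_f. Qed.

(** The corner between [d] and [nx E d] lies on the face that arrives along [drev d] and leaves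
    along [nx E d]. *)
Lemma face_nx d : face (nx E d) = face (drev d).
Proof.
by apply/eqP; rewrite eq_porbit_mem -face_perm_drev mem_porbitS porbit_id.
Qed.

Lemma face_of F d : F \in faces E -> d \in F -> F = face d.
Proof. by case/mem_faces=> d' ->; rewrite -eq_porbit_mem => /eqP. Qed.

Lemma mem_face_perm F d : F \in faces E -> (f d \in F) = (d \in F).
Proof. by case/mem_faces=> d' ->; exact: mem_porbitS. Qed.

(** Invariance under [nx] makes [r] a function of the source vertex; invariance under [drev] makes
    that function constant along edges. *)
Lemma connected_invariant (r : dart G -> bool) : connected_without (set0 : {set G}) ->
  (forall d, r (nx E d) = r d) -> (forall d, r (drev d) = r d) -> forall d d', r d = r d'.
Proof.
move=> C rn rr; pose p x := [exists d, (source d == x) && r d].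
have rE d : r d = p (source d).
  apply/idP/existsP=> [rd|[d' /andP[/eqP S]]]; first by exists d; rewrite eqxx.
  by rewrite (nx_invariant rn S).
move=> d d'; rewrite !rE; apply: (connected_without_const C); rewrite ?inE // => x _ _.
by rewrite -rE -rr rE.
Qed.

End Rotation.

(** * Minimum degree three and its effect on rotations *)

Section ThreeConnected.
Hypothesis G3 : three_connected G.

Lemma three_connected0 : connected_without (set0 : {set G}).
Proof. by case: G3 => _ /(_ set0); rewrite cards0; apply. Qed.

(** If all neighbours of [x] were in [N], deleting [N] would cut [x] off from the rest. As [N] may
    contain [x], the set deleted is [N :\ x]; a vertex [y] remains besides [x] because there are at
    least four. *)
Lemma three_neighbours (N : {set G}) x : (#|N| <= 2)%N ->
  exists2 d, source d = x & target d \notin N.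
Proof.
move=> N2; case: (boolP [exists d, (source d == x) && (target d \notin N)]).
  by case/existsP=> d /andP[/eqP]; exists d.
rewrite negb_exists => /forallP NN; exfalso.
pose N' := N :\ x; have N'2 : (#|N'| <= 2)%N by rewrite (leq_trans _ N2) ?subset_leq_card ?subsetDl.
have [y yN] : exists y, y \notin x |: N'.
  case: (pickP [pred y | y \notin x |: N']) => [y|all_in]; first by exists y.
  have := G3.1; rewrite leqNgt => /negP[]; apply: leq_ltn_trans (_ : #|x |: N'| < 4)%N.
    by apply: subset_leq_card; apply/subsetP=> y _; have /negbFE := all_in y.
  by rewrite cardsU1; case: (_ \notin _) => /=; rewrite ?add1n ?ltnS // add0n (leq_trans N'2).
have xN' : x \notin N' by rewrite !inE eqxx.
have yN' : y \notin N' by apply: contra yN => yN; rewrite inE yN orbT.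
have: (x == x) = (y == x).
  apply: (connected_without_const (S := N') (p := fun z => z == x)) => //; first exact: G3.2.
  have nbr d : source d = x -> target d \in N'.
    move=> dx; have := NN d; rewrite dx eqxx /= negbK !inE => ->.
    by rewrite -dx eq_sym source_neq_target.
  move=> d dN tN; case: eqP => [/nbr|_]; first by rewrite (negPf tN).
  by case: eqP => // /(nbr (drev d)); rewrite target_drev (negPf dN).
move: yN; rewrite !inE eqxx; case: eqP => //.
Qed.

(** Otherwise [d] and [nx E d] would be the only darts at their source, against degree at least
    three. *)
Lemma nx_nx_neq (E : embedding G) d : nx E (nx E d) != d.
Proof.
apply/eqP=> nn.
have [d' S] := @three_neighbours [set target d; target (nx E d)] (source d)
  ltac:(by rewrite cards2; case: eqP).
move/eqP: S; rewrite -(mem_porbit_nx E) !inE => S.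
suff: d' \in [set d; nx E d] by rewrite !inE => /orP[]/eqP -> /norP[]; rewrite eqxx.
apply: (porbit_ind (P := fun d' => d' \in [set d; nx E d])) S; first by rewrite set21.
by move=> y _; rewrite !inE => /orP[]/eqP ->; rewrite ?nn eqxx ?orbT.
Qed.

Lemma nx_neq (E : embedding G) d : nx E d != d.
Proof. by apply/eqP=> n; have := nx_nx_neq E d; rewrite !n eqxx. Qed.


End ThreeConnected.

(** * Exactness for genus 0 embeddings, in primal and dual form *)

Section Planar.
Variable E : embedding G.
Hypothesis G_connected : connected_without (set0 : {set G}).
Hypothesis genus0 : genus E = 0.

Let edge := {x : {set G} | x \in edges G}.
Let face := {F : {set dart G} | F \in faces E}.

Fact edge_subproof d : [set source d; target d] \in edges G.
Proof. by apply/imsetP; exists (val d) => //; rewrite inE; exact: (valP d). Qed.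

Let edge_of d : edge := exist (fun x => x \in edges G) _ (edge_subproof d).
Let face_at d : face := exist (fun F => F \in faces E) _ (face_in_faces E d).

Let edge_of_eq d d' : (edge_of d == edge_of d') = (d' == d) || (d' == drev d).
Proof. by rewrite -eq_dart_edge. Qed.

Let edge_of_surj x : exists d, edge_of d == x.
Proof.
have /imsetP[[u v]] := valP x; rewrite inE /= => uv xuv.
by exists (exist _ (u, v) uv : dart G); apply/eqP/val_inj; rewrite /= xuv.
Qed.

Let face_at_surj F : exists d, F = face_at d.
Proof.
by have [d Fd] := mem_faces (valP F); exists d; exact: val_inj.
Qed.

Let vertex_conn (p : pred G) :
  (forall d, p (source d) = p (source (drev d))) -> forall x y, p x = p y.
Proof.
by move=> pd x y; apply: (connected_without_const (p := p) G_connected) => [d _ _||]; rewrite ?inE // pd.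
Qed.

Let face_conn (p : pred face) :
  (forall d, p (face_at d) = p (face_at (drev d))) -> forall x y, p x = p y.
Proof.
move=> pd x y; have [d ->] := face_at_surj x; have [d' ->] := face_at_surj y.
apply: (connected_invariant (E := E) (r := fun d => p (face_at d))) => // z.
by rewrite [RHS]pd; congr (p _); apply: val_inj; exact: face_nx.
Qed.

Let euler : (#|{: G}| + #|{: face}| = #|{: edge}| + 2)%N.
Proof.
rewrite !card_sig.
rewrite (eq_card (B := faces E)) // (eq_card (B := edges G)) //.
move/eqP: genus0; rewrite /genus mulf_eq0 invr_eq0 orbF.
rewrite subr_eq0 eq_sym addrAC subr_eq -!natrD eqr_nat => /eqP ->.
by rewrite addnC.
Qed.

(** The face permutation maps each face to itself and turns targets into sources. *)
Let vertex_balance (p : pred G) t :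
  \sum_(d | face_at d == t) p (source (drev d)) = \sum_(d | face_at d == t) p (source d) :> bool.
Proof.
rewrite [RHS](reindex_inj (@perm_inj _ (face_perm E))) /=.
apply: eq_big => [d|d _]; last by rewrite source_face.
congr (_ == t); apply: val_inj; rewrite /= -[face_perm E d]/(((face_perm E) ^+ 1)%g d).
by rewrite porbit_perm.
Qed.

(** Dually, [nx] permutes the darts at a vertex and, by [face_nx], turns the face of [drev d] into
    that of [nx E d]. *)
Let face_balance (p : pred face) t :
  \sum_(d | source d == t) p (face_at (drev d)) = \sum_(d | source d == t) p (face_at d) :> bool.
Proof.
rewrite [RHS](reindex_inj (@perm_inj _ (nx E))) /=.
apply: eq_big => [d|d _]; first by rewrite source_nx.
by congr (p _ : bool); apply: val_inj; rewrite /= face_nx.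
Qed.

Lemma planar_cocycle (c : dart G -> bool) : (forall d, c (drev d) = c d) ->
  (forall F, F \in faces E -> \sum_(d in F) c d = 0 :> bool) ->
  exists p : G -> bool, forall d, c d = p (source d) (+) p (target d).
Proof.
move=> cr c0; apply: (euler_exact (b := face_at) edge_of_eq) => //.
- exact: drev_neq.
- by rewrite euler.
move=> [F FE]; rewrite -[RHS](c0 F FE); apply: eq_bigl => d.
rewrite -val_eqE /=; have [d' ->] := mem_faces FE.
by rewrite eq_porbit_mem.
Qed.

(** The dual instance, with vertices and faces exchanged: [q] selects faces whose mod 2 sum is the
    cycle [c]. *)
Lemma planar_cycle (c : dart G -> bool) : (forall d, c (drev d) = c d) ->
  (forall v, \sum_(d | source d == v) c d = 0 :> bool) ->
  exists q : {set dart G} -> bool,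
    forall d, c d = q (porbit (face_perm E) d) (+) q (porbit (face_perm E) (drev d)).
Proof.
move=> cr c0.
have [|q cq] := euler_exact (b := @source G) (a := face_at) edge_of_eq edge_of_surj
  (@drev_neq) face_conn vertex_conn _ face_balance cr c0; first by rewrite -euler addnC.
(* Sets of darts that are not faces get the default value [false]. *)
exists (fun F => oapp q false (insub F)) => d.
by rewrite cq !insubT ?face_in_faces //= => *; congr (q _ (+) q _); exact: val_inj.
Qed.

End Planar.

(** * Genus 0 embeddings are polyhedral *)

Section PlanarPolyhedral.
Variable E : embedding G.
Local Notation f := (face_perm E).
Hypothesis G3 : three_connected G.
Hypothesis genus0 : genus E = 0.

(* [k] is a mod 2 set of darts leaving [S]; the edges carrying it are those crossed
   by a closed curve that meets the graph only in [S]. *)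
Lemma planar_curve (S : {set G}) (k : dart G -> bool) : (#|S| <= 2)%N ->
  (forall d, k d -> source d \in S) ->
  (forall F, F \in faces E -> \sum_(d in F) (k d (+) k (drev d)) = 0 :> bool) ->
  forall x y, source x = source y -> target x \notin S -> target y \notin S -> k x = k y.
Proof.
move=> S2 kS k0.
have [|p cp] := planar_cocycle (three_connected0 G3) genus0 _ k0.
  by move=> d; rewrite drevK addbC.
have k0' d : source d \notin S -> k d = false.
  by move=> dS; apply/negbTE; apply: contra dS; exact: kS.
have pc x y : x \notin S -> y \notin S -> p x = p y.
  apply: (connected_without_const (G3.2 S S2)) => d dS tS.
  by have := cp d; rewrite !k0' //; case: (p (source d)); case: (p (target d)).
move=> x y sxy xS yS.
(* The potential [p] is constant off [S], so both edges cross the cut or neither does; [k] vanishes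
   on their reverses, which start off [S]. *)
have := cp y; have := cp x; rewrite sxy (pc _ _ xS yS) (k0' (drev x)) // (k0' (drev y)) //.
by rewrite !addbF => ->.
Qed.

(** The arc [k] changes only at the corners just before [x] and [y]. Shifting the terms [k d] along
    the face pairs them into the two darts of each corner of [F]. *)
Lemma face_arc_sum (k : dart G -> bool) x y F :
  (forall z, k (nx E z) (+) k z = (nx E z == x) (+) (nx E z == y)) -> F \in faces E ->
  \sum_(d in F) (k d (+) k (drev d)) = (x \in F) (+) (y \in F) :> bool.
Proof.
move=> kE FE; rewrite -!(sum_indicator (fun d => d \in F)).
have shift r : \sum_(d in F) r d = \sum_(d in F) r (f d) :> bool.
  by rewrite (reindex_inj (@perm_inj _ f)); apply: eq_bigl => d; rewrite mem_face_perm.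
rewrite big_split /= [X in X + _]shift [X in _ = X (+) _]shift [X in _ = _ (+) X]shift.
rewrite -[RHS]big_split -[LHS]big_split /=; apply: eq_bigr => d _.
by rewrite face_permE; exact: kE.
Qed.

Lemma mem_face_eq F K d : F \in faces E -> K \in faces E -> d \in F -> (d \in K) = (K == F).
Proof.
move=> FE KE dF; apply/idP/eqP => [dK|-> //].
by rewrite (face_of KE dK) (face_of FE dF).
Qed.

Lemma nx_surj d : exists2 d', nx E d' = d & source d' = source d.
Proof.
by exists ((nx E)^-1%g d); [rewrite permKV | rewrite -[LHS](source_nx E) permKV].
Qed.

(** If [F] visits a vertex twice, a closed curve inside [F] meets the graph only there. The arc [k]
    from [x] to [y] is then constant on the darts at that vertex by [planar_curve], yet it changes
    just before [x]. *)
Lemma face_source_inj F : F \in faces E -> {in F &, injective (@source G)}.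
Proof.
move=> FE x y xF yF sxy; apply/eqP; apply: contraT => xy.
have [|k [kx kE]] := @porbit_arc _ (nx E) x y; first by rewrite mem_porbit_nx sxy.
have [w nw sw] := nx_surj x; have := kE w.
have -> : k w = k (nx E w); last by rewrite addbb nw eqxx (negPf xy).
apply: (planar_curve (S := [set source x])); rewrite ?cards1 //.
- by move=> d /kx; rewrite mem_porbit_nx inE.
- by move=> K KE; rewrite (face_arc_sum kE KE) !(mem_face_eq FE KE) // addbb.
- by rewrite nw.
- by rewrite inE -sw eq_sym source_neq_target.
- by rewrite inE nw eq_sym source_neq_target.
Qed.

(** A closed curve runs through [F1], [u], [F2], [v], with arcs [k1] at [u] and [k2] at [v]. Since
    [k1] is constant on darts from [u] not ending at [v], each of its two changes involves a dart
    from [u] to [v]. The last conjunct says that the edge lies on both faces, as [nx E d] and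
    [drev d] share a face. *)
Lemma common_vertices F1 F2 u v : F1 \in faces E -> F2 \in faces E -> F1 != F2 -> u != v ->
  u \in face_vertices F1 :&: face_vertices F2 -> v \in face_vertices F1 :&: face_vertices F2 ->
  exists d, [/\ source d = u, target d = v &
    (d \in F1) && (nx E d \in F2) || (d \in F2) && (nx E d \in F1)].
Proof.
move=> F1E F2E F12 uv /setIP[/imsetP[x1 x1F ux1] /imsetP[x2 x2F ux2]].
move=> /setIP[/imsetP[y1 y1F vy1] /imsetP[y2 y2F vy2]].
have [|k1 [k1x k1E]] := @porbit_arc _ (nx E) x1 x2; first by rewrite mem_porbit_nx -ux1 ux2.
have [|k2 [k2y k2E]] := @porbit_arc _ (nx E) y1 y2; first by rewrite mem_porbit_nx -vy1 vy2.
have x12 : x1 != x2.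
  apply: contraNneq F12 => x12.
  by rewrite eq_sym -(mem_face_eq F1E F2E x1F) x12.
have k2u d : source d = u -> k2 d = false.
  move=> du; apply/negbTE; apply: contra uv => /k2y.
  by rewrite mem_porbit_nx -vy1 du.
have k1c d d' : source d = u -> source d' = u -> target d != v -> target d' != v -> k1 d = k1 d'.
  move=> du d'u dv d'v.
  have tS z : source z = u -> target z != v -> target z \notin [set u; v].
    by move=> zu zv; rewrite !inE negb_or zv -zu eq_sym source_neq_target.
  suff: k1 d (+) k2 d = k1 d' (+) k2 d' by rewrite !k2u // !addbF.
  apply: (planar_curve (S := [set u; v]) (k := fun z => k1 z (+) k2 z)); rewrite ?du ?d'u ?tS //.
  - by rewrite cards2; case: (_ == _).
  - move=> z; have := k1x z; have := k2y z; rewrite !mem_porbit_nx -ux1 -vy1 !inE.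
    by case: (k1 z) => [_ /(_ isT) ->|/=] // kz _ /kz ->; rewrite orbT.
  - move=> K KE.
    rewrite (eq_bigr (fun z => (k1 z (+) k1 (drev z)) + (k2 z (+) k2 (drev z)))); last first.
      by move=> z _; exact: addrACA.
    rewrite big_split /= (face_arc_sum k1E KE) (face_arc_sum k2E KE).
    rewrite (mem_face_eq F1E KE x1F) (mem_face_eq F1E KE y1F).
    by rewrite (mem_face_eq F2E KE x2F) (mem_face_eq F2E KE y2F); exact: addbb.
have near x : source x = u -> (x == x1) || (x == x2) ->
    exists d, [/\ source d = u, target d = v & (d == x) || (nx E d == x)].
  move=> xu x_12; have [w nw sw] := nx_surj x.
  case: (eqVneq (target x) v) => [xv|xv]; first by exists x; rewrite eqxx.
  case: (eqVneq (target w) v) => [wv|wv].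
    by exists w; rewrite sw nw eqxx orbT.
  have := k1E w; rewrite (k1c w (nx E w)) ?nw ?sw // addbb.
  by case/orP: x_12 => /eqP ->; rewrite eqxx ?(negPf x12) // eq_sym (negPf x12).
have [d1 [d1u d1v d1x]] := near x1 (esym ux1) ltac:(by rewrite eqxx).
have [d2 [d2u d2v d2x]] := near x2 (esym ux2) ltac:(by rewrite eqxx orbT).
(* The graph is simple, so both changes of [k1] occur next to the same dart, one on each side of
   it. *)
have E12 : d2 = d1 by apply: dart_eq; rewrite ?d1u ?d1v.
rewrite E12 in d2x; exists d1; split=> //.
case/orP: d1x => /eqP d1x; case/orP: d2x => /eqP d2x.
- by move: x12; rewrite -d1x -d2x eqxx.
- by rewrite d2x x2F d1x x1F.
- by rewrite d1x d2x x1F x2F orbT.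
- by move: x12; rewrite -d1x -d2x eqxx.
Qed.

(** The edges from [u] to [v] and to [w] would both lie on both faces. As each face has one dart at
    [u], the two edges coincide or each follows the other in the rotation, against degree three. *)
Lemma common_vertices_le2 F1 F2 u v w :
  F1 \in faces E -> F2 \in faces E -> F1 != F2 -> u != v -> u != w -> v != w ->
  u \in face_vertices F1 :&: face_vertices F2 -> v \in face_vertices F1 :&: face_vertices F2 ->
  w \in face_vertices F1 :&: face_vertices F2 -> False.
Proof.
move=> F1E F2E F12 uv uw vw uV vV wV.
have [d [du dv dF]] := common_vertices F1E F2E F12 uv uV vV.
have [d' [d'u d'w d'F]] := common_vertices F1E F2E F12 uw uV wV.
have dd' : d != d' by apply: contraNneq vw => dd'; rewrite -dv -d'w dd'.
have inj F x y : F \in faces E -> x \in F -> y \in F -> source x = u -> source y = u -> x = y.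
  by move=> FE xF yF xu yu; apply: (face_source_inj FE); rewrite ?xu.
have nu : source (nx E d) = u by rewrite source_nx.
have n'u : source (nx E d') = u by rewrite source_nx.
case/orP: dF => /andP[a b]; case/orP: d'F => /andP[a' b'].
- by move: dd'; rewrite (inj _ _ _ F1E a a') ?eqxx.
- by have := nx_nx_neq G3 E d; rewrite (inj _ _ _ F2E b a') // (inj _ _ _ F1E b' a) // eqxx.
- by have := nx_nx_neq G3 E d; rewrite (inj _ _ _ F1E b a') // (inj _ _ _ F2E b' a) // eqxx.
- by move: dd'; rewrite (inj _ _ _ F2E a a') ?eqxx.
Qed.

Lemma face_edge_vertices F d : F \in faces E -> [set source d; target d] \in face_edges F ->
  source d \in face_vertices F /\ target d \in face_vertices F.
Proof.
move=> FE /imsetP[x xF /eqP].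
have xs : source x \in face_vertices F by exact: imset_f.
have xt : target x \in face_vertices F.
  by rewrite -(source_face E) imset_f // mem_face_perm.
by rewrite eq_dart_edge => /orP[]/eqP E1; move: xs xt; rewrite E1.
Qed.

Lemma planar_polyhedral : polyhedral E.
Proof.
split=> [F FE|F1 F2 F1E F2E F12].
  split; last exact: face_source_inj.
  have [d dF] := mem_faces FE.
  have [dd fd ffd] : [/\ d \in F, f d \in F & f (f d) \in F].
    by rewrite dF !mem_porbitS porbit_id.
  have n1 x : x != f x.
    by apply: contraTneq (source_neq_target x) => xx; rewrite -(source_face E) -xx eqxx.
  (* A face of length two would turn back along its edge, making [drev d] a fixed point of the
     rotation. *)
  have n2 : d != f (f d).
    apply/eqP=> fE; have : drev d = f d.
      by apply: dart_eq; rewrite ?source_face // target_drev {1}fE source_face.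
    by move/eqP; rewrite eq_sym face_permE (negPf (nx_neq G3 E _)).
  rewrite -[3%N]/(size [:: d; f d; f (f d)]) -(card_uniqP _) /=; last first.
    by rewrite !inE negb_or n1 n2 n1.
  by apply/subset_leq_card/subsetP=> x; rewrite !inE => /or3P[]/eqP ->.
set VI := face_vertices F1 :&: face_vertices F2.
set EI := face_edges F1 :&: face_edges F2.
have EIV x : x \in EI -> exists d,
    [/\ x = [set source d; target d], source d \in VI & target d \in VI].
  move=> /[dup] /setIP[x1 x2]; case/imsetP: (x1) => d dF xd _; exists d.
  move: x1 x2; rewrite xd => /(face_edge_vertices F1E)[a b] /(face_edge_vertices F2E)[a' b'].
  by rewrite !inE a b a' b'.
have EI0 : (forall d, source d \in VI -> target d \in VI -> False) -> EI = set0.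
  move=> no; apply/setP=> x; rewrite in_set0; apply/negbTE/negP => /EIV[d [_ a b]]; exact: no a b.
case: (set_0Vmem VI) => [VI0|[u uV]].
  by constructor 1; split=> //; apply: EI0 => d; rewrite VI0 inE.
case: (set_0Vmem (VI :\ u)) => [VI0|[v]].
  have VIu : VI = [set u] by rewrite -(setD1K uV) VI0 setU0.
  constructor 2; exists u; split=> //; apply: EI0 => d; rewrite VIu !inE => /eqP su /eqP tu.
  by have := source_neq_target d; rewrite su tu eqxx.
rewrite in_setD1 eq_sym => /andP[uv vV].
have VIuv : VI = [set u; v].
  apply/eqP; rewrite eqEsubset; apply/andP; split; last by rewrite subUset !sub1set uV.
  apply/subsetP=> w wV; rewrite !inE; apply: contraT; rewrite negb_or ![w == _]eq_sym => /andP[uw vw].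
  by case: (common_vertices_le2 F1E F2E F12 uv uw vw uV vV wV).
have [d [du dv dF]] := common_vertices F1E F2E F12 uv uV vV.
constructor 3; exists u, v; split=> //; first by rewrite -du -dv; exact: valP d.
have dEI : [set u; v] \in EI.
  have rev F : F \in faces E -> nx E d \in F -> [set u; v] \in face_edges F.
    move=> FE; rewrite -face_perm_drev mem_face_perm // => dF'.
    by apply/imsetP; exists (drev d); rewrite // source_drev target_drev du dv setUC.
  have fwd (F : {set dart G}) : d \in F -> [set u; v] \in face_edges F.
    by move=> dF'; apply/imsetP; exists d; rewrite // du dv.
  by rewrite inE; case/orP: dF => /andP[a b]; rewrite (fwd _ a) (rev _ _ b).
apply/eqP; rewrite eqEsubset sub1set dEI andbT; apply/subsetP=> x /EIV[z [-> ]].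
rewrite VIuv in_set1 eq_sym -du -dv eq_dart_edge !inE => sz tz.
have := source_neq_target z; case/orP: sz => /eqP sz; case/orP: tz => /eqP tz; rewrite sz tz ?eqxx // => _.
  by apply/orP; left; apply/eqP/dart_eq.
by apply/orP; right; apply/eqP/dart_eq.
Qed.

End PlanarPolyhedral.

(** * Faces of polyhedral embeddings *)

Section Uniqueness.
Hypothesis G3 : three_connected G.

Section PolyhedralFace.
Variables (E : embedding G) (F : {set dart G}).
Local Notation f := (face_perm E).
Local Notation V := (face_vertices F).
Hypothesis polyE : polyhedral E.
Hypothesis FE : F \in faces E.

Lemma polyhedral_source_inj K : K \in faces E -> {in K &, injective (@source G)}.
Proof. by case/polyE.1. Qed.

Lemma polyhedral_target_inj : {in F &, injective (@target G)}.
Proof.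
move=> x y xF yF txy; apply: (@perm_inj _ f); apply: (polyhedral_source_inj FE).
- by rewrite mem_face_perm.
- by rewrite mem_face_perm.
- by rewrite !source_face.
Qed.

Lemma face_source_vertex d : d \in F -> source d \in V.
Proof. exact: imset_f. Qed.

Lemma face_target_vertex d : d \in F -> target d \in V.
Proof. by move=> dF; rewrite -(source_face E) face_source_vertex ?mem_face_perm. Qed.

(** Otherwise [drev d] and [f d] are two darts of [F] with the same source. *)
Lemma polyhedral_drev d : d \in F -> drev d \notin F.
Proof.
move=> dF; apply/negP=> rF; have : f d = drev d.
  by apply: (polyhedral_source_inj FE); rewrite ?mem_face_perm // source_face.
by apply/eqP; rewrite face_permE nx_neq.
Qed.

(** If [d] is not in [F], its face meets [F] in both ends of [d]; the intersection is then a single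
    edge, necessarily that of [d]. *)
Lemma polyhedral_induced d : source d \in V -> target d \in V -> d \in F \/ drev d \in F.
Proof.
move=> sV tV; case: (eqVneq F (porbit f d)) => [->|FK]; first by left; exact: porbit_id.
have KE := face_in_faces E d.
have sI : source d \in V :&: face_vertices (porbit f d).
  by rewrite inE sV imset_f ?porbit_id.
have tI : target d \in V :&: face_vertices (porbit f d).
  by rewrite inE tV -(source_face E) imset_f // mem_porbitS porbit_id.
case: (polyE.2 _ _ FE KE FK) => [[V0 _]|[v [V1 _]]|[u [v [uv V2 E2]]]].
- by rewrite V0 inE in sI.
- move: sI tI; rewrite V1 !inE => /eqP sv /eqP tv.
  by have := source_neq_target d; rewrite sv tv eqxx.
have [z [zu zv]] := dart_of uv.
have: [set u; v] \in face_edges F :&: face_edges (porbit f d) by rewrite E2 inE.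
case/setIP=> /imsetP[x xF /eqP]; rewrite -zu -zv eq_dart_edge => xz _.
have dz : (d == z) || (d == drev z).
  move: sI tI; rewrite V2 -zu -zv !inE; have := source_neq_target d.
  move=> N /orP[]/eqP S /orP[]/eqP T; move: N; rewrite S T ?eqxx // => _.
  - by rewrite (dart_eq S T) eqxx.
  - by rewrite (dart_eq (d' := drev z) S T) eqxx orbT.
case/orP: xz xF => /eqP-> ; case/orP: dz => /eqP-> ; rewrite ?drevK; by [left|right].
Qed.

(** So the darts leading back to [F] are consecutive in the rotation, and those leaving [F] form one
    run, starting at [nx E y]. *)
Lemma face_darts_at y d : y \in F -> source d = source y -> target d \in V ->
  d = y \/ nx E d = y.
Proof.
move=> yF sdy tV; have sV : source d \in V by rewrite sdy face_source_vertex.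
case: (polyhedral_induced sV tV) => dF.
  by left; exact: (polyhedral_source_inj FE).
right; rewrite -face_perm_drev; apply: (polyhedral_source_inj FE) => //.
  by rewrite mem_face_perm.
by rewrite source_face.
Qed.

(** * A face of a polyhedral embedding does not separate the graph *)

Section Separation.
Variable p : G -> bool.
Hypothesis p_outside : forall d,
  source d \notin V -> target d \notin V -> p (source d) = p (target d).

(** Removing from the cycle [K] nothing, a vertex or an edge with its ends leaves a connected
    piece. *)
Lemma face_outside_const K x y : K \in faces E -> K != F -> x \in K -> y \in K ->
  source x \notin V -> source y \notin V -> p (source x) = p (source y).
Proof.
move=> KE KF xK yK.
(* The dart [h] starts at the last vertex of [K] on [F], or anywhere if there is none; the walk from
   [f h] round to [h] then never re-emerges from [F]. *)
have [h [hK hV hlast]] : exists h, [/\ h \in K,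
    forall z, z \in K -> source z \in V -> source h \in V
  & forall z, z \in K -> z != h -> source z \in V -> f z = h].
  have inI z : z \in K -> source z \in V -> source z \in V :&: face_vertices K.
    by move=> zK zV; rewrite inE zV imset_f.
  have FK : F != K by rewrite eq_sym.
  case: (polyE.2 _ _ FE KE FK) => [[V0 _]|[v [V1 _]]|[u [v [uv V2 E2]]]].
  - exists x; split=> // z zK; first by move=> /(inI z zK); rewrite V0 inE.
    by move=> _ /(inI z zK); rewrite V0 inE.
  - have: v \in V :&: face_vertices K by rewrite V1 inE.
    case/setIP=> vV /imsetP[h hK hv]; exists h; split=> // [z _ _|z zK zh zV].
      by rewrite -hv.
    have := inI z zK zV; rewrite V1 inE => /eqP zv; case/eqP: zh.
    by apply: (polyhedral_source_inj KE) => //; rewrite zv.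
  have: [set u; v] \in face_edges F :&: face_edges K by rewrite E2 inE.
  case/setIP=> _ /imsetP[g gK uvg]; rewrite uvg in V2.
  exists (f g); split=> [|z zK zV|z zK zfg zV]; first by rewrite mem_face_perm.
    have: target g \in V :&: face_vertices K by rewrite V2 set22.
    by rewrite source_face => /setIP[].
  have := inI z zK zV; rewrite V2 !inE => /orP[]/eqP S.
    by congr (f _); exact: (polyhedral_source_inj KE).
  case/eqP: zfg; apply: (polyhedral_source_inj KE) => //; first by rewrite mem_face_perm.
  by rewrite source_face.
have P z : z \in porbit f (f h) -> source z \notin V -> p (source z) = p (source (f h)).
  apply: (porbit_ind (P := fun z => source z \notin V -> p (source z) = p (source (f h)))) => //.
  move=> {}z zK IH fzV; case: (eqVneq z h) => [->//|zh].
  have zK' : z \in K by rewrite (face_of KE (d := f h)) ?mem_face_perm.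
  case: (boolP (source z \in V)) => zV.
    by move: fzV; rewrite (hlast _ zK' zh zV) (hV _ zK' zV).
  rewrite source_face in fzV *; rewrite -p_outside //; exact: IH.
have KfH : K = porbit f (f h) by apply: face_of => //; rewrite mem_face_perm.
by move=> xV yV; rewrite !P // -KfH.
Qed.

(** Both targets lie on the face at the corner between the two darts. *)
Lemma nx_outside d : target d \notin V -> target (nx E d) \notin V ->
  p (target d) = p (target (nx E d)).
Proof.
move=> dV nV; set K := porbit f (drev d).
have KE : K \in faces E := face_in_faces E _.
have rK : drev d \in K by exact: porbit_id.
rewrite -[target d]source_drev -(source_face E (nx E d)).
apply: (face_outside_const KE) => //; last by rewrite source_face.
  by apply: contraNneq dV => KF; rewrite KF in rK; exact: face_source_vertex rK.
by rewrite -face_perm_drev !mem_face_perm.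
Qed.

Lemma vertex_outside y d : y \in F -> source d = source y -> target d \notin V ->
  p (target d) = p (target (nx E y)).
Proof.
move=> yF sdy; have : d \in porbit (nx E) (nx E y) by rewrite mem_porbit_nx source_nx sdy.
apply: (porbit_ind (P := fun d => target d \notin V -> p (target d) = p (target (nx E y)))) => // z.
rewrite mem_porbit_nx source_nx => /eqP sz IH nV.
case: (boolP (target z \in V)) => zV; last by rewrite -nx_outside // IH.
case: (face_darts_at yF sz zV) => [->//|nz].
by move: nV; rewrite nz face_target_vertex.
Qed.

Lemma nx_face_outside y : y \in F -> target (nx E y) \notin V.
Proof.
move=> yF; apply/negP=> tV.
case: (face_darts_at yF (source_nx E y) tV) => /eqP; first by rewrite (negPf (nx_neq G3 E y)).
by rewrite (negPf (nx_nx_neq G3 E y)).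
Qed.

(** The face across the edge of [y] passes [target w], [target y], [source y], [target (nx E y)] in
    this order, where [w] precedes [drev y] in the rotation; its first and last vertices here are
    off [F]. *)
Lemma next_vertex_outside y : y \in F -> p (target (nx E y)) = p (target (nx E (f y))).
Proof.
move=> yF; have [w nw sw] := nx_surj E (drev y).
have fyF : f y \in F by rewrite mem_face_perm.
have swy : source w = source (f y) by rewrite source_face sw source_drev.
have wV : target w \notin V.
  apply/negP=> /(face_darts_at fyF swy)[|] wfy.
    by have := nx_nx_neq G3 E w; rewrite nw -face_permE wfy eqxx.
  have := nx_neq G3 E (drev y).
  by rewrite -face_permE -wfy nw eqxx.
rewrite -(vertex_outside fyF swy wV).
set K := porbit f (drev y).
have KE : K \in faces E := face_in_faces E _.
have rK : drev y \in K by exact: porbit_id.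
rewrite -[target w]source_drev -(source_face E (nx E y)).
apply: (face_outside_const KE).
- by apply: contraNneq (polyhedral_drev yF) => KF; rewrite -KF.
- by rewrite -face_perm_drev !mem_face_perm.
- by rewrite -(mem_face_perm _ KE) face_perm_drev nw.
- by rewrite source_face nx_face_outside.
- by rewrite source_drev.
Qed.

Lemma polyhedral_nonseparating x y : x \notin V -> y \notin V -> p x = p y.
Proof.
have [y0 Fy0] := mem_faces FE; pose b := p (target (nx E y0)).
have b_eq z : z \in F -> p (target (nx E z)) = b.
  rewrite Fy0; apply: (porbit_ind (P := fun z => p (target (nx E z)) = b)) => // {}z.
  by rewrite -Fy0 => zF; rewrite -next_vertex_outside.
have enter d : source d \in V -> target d \notin V -> p (target d) = b.
  by case/imsetP=> z zF sdz dV; rewrite (vertex_outside zF sdz dV) b_eq.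
(* All edges leaving [F] reach the same value [b], so giving [b] to [F] itself makes the function
   locally constant on the whole connected graph. *)
pose p' x := if x \in V then b else p x.
move=> xV yV; have: p' x = p' y; last by rewrite /p' (negPf xV) (negPf yV).
apply: (connected_without_const (three_connected0 G3)); rewrite ?inE // => d _ _.
rewrite /p'; case: ifPn => sV; case: ifPn => tV //.
- by rewrite enter.
- by rewrite -[source d]target_drev enter.
- exact: p_outside.
Qed.

End Separation.

Lemma face_vertex_balance v :
  \sum_(d | source d == v) ((d \in F) (+) (drev d \in F)) = 0 :> bool.
Proof.
rewrite big_split /= (reindex_inj (@perm_inj _ (nx E))).
rewrite (eq_big (fun d => source d == v) (fun d => drev d \in F)) => [||d _].
- exact: addbb.
- by move=> d; rewrite source_nx.
- by rewrite -face_perm_drev mem_face_perm.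
Qed.

(** The alternatives say that [E0] has the face [F], or its reverse. *)
Lemma polyhedral_face_match (E0 : embedding G) : genus E0 = 0 ->
  (forall d, d \in F -> face_perm E0 d = f d) \/
  (forall d, d \in F -> face_perm E0 (drev (f d)) = drev d).
Proof.
move=> genus0; pose c d := (d \in F) (+) (drev d \in F).
have [|q cq] := @planar_cycle E0 (three_connected0 G3) genus0 c _ face_vertex_balance.
  by move=> d; rewrite /c drevK addbC.
pose f0 := face_perm E0; pose Q d := q (porbit f0 d).
have Qf d : Q (f0 d) = Q d by congr q; apply/esym/face_of; rewrite ?face_in_faces ?mem_porbitS ?porbit_id.
have Qnx d : Q (nx E0 d) = Q (drev d) by rewrite -face_perm_drev Qf.
(* An edge with an end off [F] is not in the cycle [c], so its two sides in [E0] get the same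
   value. *)
have Qrev d : source d \notin V -> Q (drev d) = Q d.
  move=> dV; have : c d = false.
    rewrite /c (negbTE (contra (@face_source_vertex d) dV)).
    by rewrite -target_drev in dV; rewrite (negbTE (contra (@face_target_vertex _) dV)).
  by rewrite cq -/(Q d) -/(Q (drev d)); case: (Q d); case: (Q _).
have Qsource d d' : source d = source d' -> source d' \notin V -> Q d = Q d'.
  move=> sdd' dV; have : d \in porbit (nx E0) d' by rewrite mem_porbit_nx sdd'.
  apply: (porbit_ind (P := fun d => Q d = Q d')) => // z.
  by rewrite mem_porbit_nx Qnx => /eqP sz; rewrite Qrev // sz.
pose p x := [exists d, (source d == x) && Q d].
have Qp d : source d \notin V -> Q d = p (source d).
  move=> dV; apply/idP/existsP=> [Qd|[z /andP[/eqP sz]]]; first by exists d; rewrite eqxx.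
  by rewrite (Qsource z d).
have p_out d : source d \notin V -> target d \notin V -> p (source d) = p (target d).
  by move=> sV tV; rewrite -Qp // -Qrev // -[target d]source_drev Qp.
have [b Qb] : exists b, forall d, source d \notin V -> Q d = b.
  case: (pickP [pred d | source d \notin V]) => [d0 /= d0V|no]; last first.
    by exists true => d dV; have := no d; rewrite /= dV.
  exists (Q d0) => d dV; rewrite !Qp //; exact: polyhedral_nonseparating.
(* A face of [E0] on the other side stays on the vertices of [F], hence on its edges, because [F] is
   induced. *)
have step x : Q x = ~~ b -> f0 x \in F \/ drev (f0 x) \in F.
  move=> Qx; have inV z : Q z = ~~ b -> source z \in V.
    by move=> Qz; apply: contraT => /Qb; rewrite Qz; case: (b).
  by apply: polyhedral_induced; [|rewrite -(source_face E0)]; apply: inV; rewrite !Qf.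
have nrev z : f0 z <> drev z by move/eqP; rewrite /f0 face_permE (negPf (nx_neq G3 _ _)).
have [d Fd] := mem_faces FE.
have dF : d \in F by rewrite Fd porbit_id.
have : c d by rewrite /c dF (negPf (polyhedral_drev dF)).
rewrite cq -/(Q d) -/(Q (drev d)) => Qd.
have {Qd} [Qd|Qd] : Q d = ~~ b \/ Q (drev d) = ~~ b.
- by move: Qd; case: (Q d); case: (Q _); case: (b) => //; by [left|right].
- left.
  (* At [target z] the only edges of [F] lead forward along [f z] or back along [drev z], and a face
     never turns back. *)
  have fwd z : z \in F -> Q z = ~~ b -> f0 z = f z.
    move=> zF Qz; case: (step z Qz) => fF.
      by apply: (polyhedral_source_inj FE) => //; rewrite ?mem_face_perm // !source_face.
    case: (nrev z); rewrite -[LHS]drevK; congr drev.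
    by apply: polyhedral_target_inj => //; rewrite target_drev source_face.
  suff QF z : z \in F -> Q z = ~~ b by move=> z zF; apply: fwd (QF z zF).
  rewrite {1}Fd; apply: (porbit_ind (P := fun z => Q z = ~~ b)) => // {}z.
  by rewrite -Fd => zF Qz; rewrite -fwd // Qf.
- right.
  have bwd z : z \in F -> Q (drev (f z)) = ~~ b -> f0 (drev (f z)) = drev z.
    move=> zF Qz; have fzF : f z \in F by rewrite mem_face_perm.
    case: (step _ Qz) => fF.
      case: (nrev (drev (f z))); rewrite drevK.
      by apply: (polyhedral_source_inj FE) => //; rewrite [LHS](source_face E0).
    rewrite -[LHS]drevK; congr drev.
    by apply: polyhedral_target_inj => //; rewrite target_drev (source_face E0) target_drev source_face.
  suff QF z : z \in F -> Q (drev z) = ~~ b.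
    by move=> z zF; apply: bwd (QF _ _) => //; rewrite mem_face_perm.
  (* The reversed face runs through [F] backwards, hence induction along the inverse of [f]. *)
  rewrite {1}Fd -porbitV; apply: (porbit_ind (P := fun z => Q (drev z) = ~~ b)) => // {}z.
  rewrite porbitV -Fd => zF; rewrite -{1}[z](permKV f) => Qz.
  by rewrite -bwd ?Qf // -(mem_face_perm _ FE) permKV.
Qed.

End PolyhedralFace.

(** * From matching faces to equivalent embeddings *)

Lemma embedding_eq (E E' : embedding G) : nx E = nx E' -> E = E'.
Proof. by case: E E' => n i [n' i'] /= nn; subst n'; rewrite (bool_irrelevance i i'). Qed.

Lemma mirrorK : involutive (@mirror G).
Proof. by move=> E; apply: embedding_eq; rewrite /= invgK. Qed.

Lemma polyhedral_equivalent_planar (E E0 : embedding G) :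
  polyhedral E -> genus E0 = 0 -> equivalent E E0.
Proof.
move=> polyE genus0; pose same z := nx E z == nx E0 z.
pose opposite z := nx E0 (nx E z) == z.
have not_both z : same z -> opposite z -> False.
  move=> /eqP sz /eqP oz; have := nx_nx_neq G3 E0 z; by rewrite -{1}sz oz eqxx.
(* Matching the face of [d] settles all its corners alike, in particular two consecutive ones. *)
have corner d : (same (drev d) /\ same (drev (face_perm E d))) \/
                (opposite (drev d) /\ opposite (drev (face_perm E d))).
  have dF := porbit_id (face_perm E) d.
  have fF : face_perm E d \in porbit (face_perm E) d by rewrite mem_porbitS.
  have [M|M] := polyhedral_face_match polyE (face_in_faces E d) genus0; [left|right].
    by split; apply/eqP; rewrite -!face_permE M.
  by split; apply/eqP; rewrite -face_permE -[nx E0 _]face_perm_drev M.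
have same_or_opposite z : same z || opposite z.
  by case: (corner (drev z)); rewrite drevK => -[-> _]; rewrite ?orbT.
have same_rev_nx z : same (drev (nx E z)) = same z.
  have := corner (drev z); rewrite drevK face_perm_drev.
  case=> -[a b]; first by rewrite a b.
  by apply/idP/idP => S; [case: (not_both _ S b)|case: (not_both _ S a)].
(* A switch between agreeing and opposite at consecutive corners of a vertex would force
   [nx E (nx E z) = z]. *)
have same_nx z : same (nx E z) = same z.
  apply/idP/idP => S.
    case/orP: (same_or_opposite z) => // /eqP oz; have := nx_nx_neq G3 E z.
    by rewrite (eqP S) oz eqxx.
  case/orP: (same_or_opposite (nx E z)) => // /eqP; rewrite [X in _ = X -> _](eqP S) => /perm_inj.
  by move/eqP; rewrite (negPf (nx_nx_neq G3 E z)).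
have same_rev z : same (drev z) = same z.
  by have [w <- _] := nx_surj E z; rewrite same_rev_nx same_nx.
have same_const := connected_invariant (three_connected0 G3) same_nx same_rev.
case: (pickP same) => [z sz|none]; [left|right]; apply: embedding_eq; apply/permP=> d.
  by apply/eqP; rewrite -/(same d) (same_const d z).
have := same_or_opposite d; rewrite none => /= /eqP od.
by rewrite -{2}od permK.
Qed.

End Uniqueness.

End Graph.

Theorem mainTheorem1 (G : sgraph) :
  three_connected G -> planar G ->
  (exists E : embedding G, polyhedral E) /\
  (forall E1 E2 : embedding G, polyhedral E1 -> polyhedral E2 -> equivalent E1 E2).
Proof.
move=> G3 [E0 genus0]; split; first by exists E0; exact: planar_polyhedral.
(* Both embeddings are compared with [E0]; the equivalences compose because [mirror] is an
   involution. *)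
move=> E1 E2 /(polyhedral_equivalent_planar G3)/(_ genus0) eq1.
move=> /(polyhedral_equivalent_planar G3)/(_ genus0).
by case: eq1 => -> [] ->; [left|right; rewrite mirrorK|right|left].
Qed.
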